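(* Let $\mathcal{A}$ be a set of objects, each with a size $|A|\in\mathbb{N}$, let $B$ be a positive integer, let $\Phi,\Phi_2$ be sets, and let $f\colon\mathcal{A}\to\Phi$ be a function such that $|A|$ is determined by $f(A)$. Suppose there is a map $\mathrm{Decompose}$ assigning to each $A\in\mathcal{A}$ a tuple $\mathrm{Decompose}(A)=(\beta,A_1,\ldots,A_B)\in\Phi_2\times\mathcal{A}^B$; write $g(A)=\beta$ and $f_i(A)=f(A_i)$, and let $\mathcal{F}=\{(g(A),f_1(A),\ldots,f_B(A)) : A\in\mathcal{A}\}$. Assume: (P1) there is a function $\mathrm{Join}\colon\Phi_2\times\mathcal{A}^B\to\mathcal{A}$ with $\mathrm{Join}(\mathrm{Decompose}(A))=A$ for all $A\in\mathcal{A}$; (P2) $\mathrm{Decompose}(\mathrm{Join}(\beta,A_1,\ldots,A_B))=(\beta,A_1,\ldots,A_B)$ for all $A_1,\ldots,A_B\in\mathcal{A}$ and $\beta\in\Phi_2$ with $(\beta,f(A_1),\ldots,f(A_B))\in\mathcal{F}$; (P3) there is a function $f'\colon\mathcal{F}\to\Phi$ with $f(A)=f'(g(A),f_1(A),\ldots,f_B(A))$ for all $A\in\mathcal{A}$; (P4) there is a constant $\delta\le B/2$ such that if $\mathrm{Decompose}(A)=(\beta,A_1,\ldots,A_B)$ then $|A_i|\le\delta|A|/B$ for all $i$. For $\alpha\in\Phi$, $\beta\in\Phi_2$ let $N(\alpha,\beta)$ be the number of $A\in\mathcal{A}$ with $f(A)=\alpha$ and $g(A)=\beta$ (assumed finite),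 and let $\mathcal{X}_{\alpha,\beta}=\{(\vec{\alpha},\vec{\beta}) : \vec{\alpha}=(\alpha_1,\ldots,\alpha_B)\in\Phi^B,\ \vec{\beta}=(\beta_1,\ldots,\beta_B)\in\Phi_2^B,\ (\beta,\alpha_1,\ldots,\alpha_B)\in\mathcal{F},\ f'(\beta,\alpha_1,\ldots,\alpha_B)=\alpha\}$. Then for every $\alpha\in\Phi$ and $\beta\in\Phi_2$, $$\sum_{((\alpha_1,\ldots,\alpha_B),(\beta_1,\ldots,\beta_B))\in\mathcal{X}_{\alpha,\beta}}\ \prod_{i=1}^B N(\alpha_i,\beta_i)=N(\alpha,\beta).$$
   Context: This is the abstract setting of a ''generalized aB-tree'': objects (e.g. ordered trees) are recursively decomposed into $B$ sub-objects (some possibly of size $0$) together with a piece of reconstruction information $\beta\in\Phi_2$. *)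

(* Defs.v *)
From HB Require Import structures.
From mathcomp Require Export all_boot all_order all_algebra finmap.
From mathcomp Require Export boolp classical_sets functions cardinality reals ereal esum.
Set Implicit Arguments.
Unset Strict Implicit.
Unset Printing Implicit Defensive.

Local Open Scope classical_set_scope.

(* The whole development lives over bare types; [{classic T}] only supplies the
   classical choiceType structure required by [fset_set] and [esum]. *)

Definition decomp_info (A Phi2 : Type) (B : nat)
  (decompose : A -> Phi2 * B.-tuple A) (a : A) : Phi2 := (decompose a).1.

(* (g(A), f_1(A), ..., f_B(A)) *)
Definition signature (A Phi Phi2 : Type) (B : nat) (f : A -> Phi)
  (decompose : A -> Phi2 * B.-tuple A) (a : A) : Phi2 * B.-tuple Phi :=
  (decomp_info decompose a, map_tuple f (decompose a).2).

Definition signatures (A Phi Phi2 : Type) (B : nat) (f : A -> Phi)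
  (decompose : A -> Phi2 * B.-tuple A) : set (Phi2 * B.-tuple Phi) :=
  range (signature f decompose).

Definition objects_with (A Phi Phi2 : Type) (B : nat) (f : A -> Phi)
  (decompose : A -> Phi2 * B.-tuple A) (alpha : Phi) (beta : Phi2) : set A :=
  [set a | f a = alpha /\ decomp_info decompose a = beta].

(* [fset_set] is the empty set on infinite sets, so this is the number of
   objects only when [objects_with f decompose alpha beta] is finite. *)
Definition num_objects (A Phi Phi2 : Type) (B : nat) (f : A -> Phi)
  (decompose : A -> Phi2 * B.-tuple A) (alpha : Phi) (beta : Phi2) : nat :=
  #|` fset_set (objects_with f decompose alpha beta : set {classic A})|%fset.

(* f' is defined on F only, hence the subset type in its domain. *)
Definition label_pairs (A Phi Phi2 : Type) (B : nat) (f : A -> Phi)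
  (decompose : A -> Phi2 * B.-tuple A)
  (f' : {s | signatures f decompose s} -> Phi) (alpha : Phi) (beta : Phi2) :
  set (B.-tuple Phi * B.-tuple Phi2) :=
  [set x | exists Fx : signatures f decompose (beta, x.1),
             f' (exist _ (beta, x.1) Fx) = alpha].

(* Main.v *)
(** Sending an object to its labelled tuple of sub-objects is a bijection from
    the objects with labels [(alpha, beta)] onto the disjoint union, over the
    label pairs [x], of the boxes of tuples whose [i]-th entry has labels
    [(x.1_i, x.2_i)]: (P1) gives injectivity, (P2) and (P3) surjectivity. Counting
    both sides as sums of ones gives the identity. *)
Require Import Defs.
From mathcomp Require Import all_boot all_order all_algebra finmap.
From mathcomp Require Import boolp classical_sets functions cardinality reals ereal esum.
From mathcomp Require Import fsbigop.

Local Open Scope classical_set_scope.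
Local Open Scope ring_scope.

Lemma esum_card (R : realType) (T : choiceType) (D : set T) :
  finite_set D -> (\esum_(x in D) 1 = (#|` fset_set D|%:R : R)%:E)%E.
Proof.
move=> finD; rewrite esum_fset// fsbig_finite//= sumEFin.
by rewrite big_const_seq count_predT GRing.iter_addr_0.
Qed.

Definition tuple_box {T : Type} {n : nat} (S : 'I_n -> set T) : set (n.-tuple T) :=
  [set t | forall i, S i (tnth t i)].

Section TupleBox.
Variables (T : choiceType) (n : nat) (S : 'I_n -> set T).
Hypothesis finS : forall i, finite_set (S i).

(** Choosing one element from each finite [S i] is a point of a finite dependent function type,
    whose cardinality [card_dep_ffun] gives as a product; [to_tuple] carries this count over to
    tuples. *)
Let choices := {dffun forall i : 'I_n, fset_set (S i)}.
Let to_tuple (u : choices) : n.-tuple T := [tuple val (u i) | i < n].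

Let to_tuple_inj : injective to_tuple.
Proof.
move=> u v /(congr1 (@tnth _ _)) uv; apply/ffunP => i; apply: val_inj.
by move: (congr1 (@^~ i) uv); rewrite !tnth_mktuple.
Qed.

Let tuple_boxE : tuple_box S = to_tuple @` setT.
Proof.
apply/seteqP; split => [t St|_ [u _ <-] i]; last first.
  by rewrite tnth_mktuple; move: (valP (u i)); rewrite in_fset_set// inE.
have tS i : tnth t i \in fset_set (S i) by rewrite in_fset_set// inE; exact: St.
exists [ffun i => FSetSub (tS i)] => //.
by apply: eq_from_tnth => i; rewrite tnth_mktuple ffunE.
Qed.

Lemma finite_tuple_box : finite_set (tuple_box S).
Proof. by rewrite tuple_boxE; apply: finite_image; exact: finite_finset. Qed.

Lemma card_tuple_box :
  #|` fset_set (tuple_box S)| = (\prod_(i < n) #|` fset_set (S i)|)%N.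
Proof.
have finC : finite_set [set: choices] by exact: finite_finset.
rewrite tuple_boxE fset_set_image//.
rewrite card_imfset//=; transitivity #|choices|.
  rewrite cardE; apply: perm_size; apply: uniq_perm => [||u].
  - exact: fset_uniq.
  - exact: enum_uniq.
  - by rewrite mem_enum in_fset_set// in_setT.
rewrite card_dep_ffun foldrE big_image/=.
by apply: eq_bigr => i _; rewrite cardfE.
Qed.

End TupleBox.

Theorem lemma2 (R : realType) (A Phi Phi2 : Type) (size : A -> nat) (B : nat)
    (B_gt0 : (0 < B)%N) (f : A -> Phi)
    (size_det : forall a a' : A, f a = f a' -> size a = size a')
    (decompose : A -> Phi2 * B.-tuple A)
    (join : Phi2 * B.-tuple A -> A)
    (P1 : forall a : A, join (decompose a) = a)
    (P2 : forall (beta : Phi2) (t : B.-tuple A),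
        signatures f decompose (beta, map_tuple f t) ->
        decompose (join (beta, t)) = (beta, t))
    (f' : {s : Phi2 * B.-tuple Phi | signatures f decompose s} -> Phi)
    (P3 : forall (a : A) (Fa : signatures f decompose (signature f decompose a)),
        f a = f' (exist _ (signature f decompose a) Fa))
    (delta : R) (delta_le : delta <= B%:R / 2)
    (P4 : forall (a : A) (i : 'I_B),
        (size (tnth (decompose a).2 i))%:R <= delta * (size a)%:R / B%:R)
    (N_fin : forall (alpha : Phi) (beta : Phi2),
        finite_set (objects_with f decompose alpha beta))
    (alpha : Phi) (beta : Phi2) :
  (\esum_(x in (label_pairs f' alpha beta
                : set {classic B.-tuple Phi * B.-tuple Phi2}))
      ((\prod_(i < B) num_objects f decompose (tnth x.1 i) (tnth x.2 i))%N%:R)%:E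
   = ((num_objects f decompose alpha beta)%:R : R)%:E)%E.
Proof.
pose box (x : {classic B.-tuple Phi * B.-tuple Phi2}) :
    set (B.-tuple {classic A}) :=
  tuple_box (fun i => objects_with f decompose (tnth x.1 i) (tnth x.2 i)).
(* A box is a fibre of the labelling of tuples: [t] determines the only [x] whose box contains
   it. *)
have boxE x : box x = [set t : B.-tuple A | map_tuple f t = x.1 /\
                          map_tuple (decomp_info decompose) t = x.2].
  apply/seteqP; split => [t xt|t [tx1 tx2] i]; last first.
    by rewrite -tx1 -tx2 !tnth_map.
  by split; apply: eq_from_tnth => i; rewrite tnth_map; case: (xt i).
rewrite /num_objects -esum_card; last exact: N_fin.
(* Each product of counts becomes a sum of ones over [box x]. *)
under eq_esum => x _.
  rewrite -card_tuple_box; last by move=> i; exact: N_fin.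
  rewrite -esum_card; last by apply: finite_tuple_box => i; exact: N_fin.
  over.
(* The double sum becomes a single sum over pairs [(x, t)] with [t] in [box x], which encode the
   disjoint union. *)
rewrite (esum_esum (J := box)) => //=.
pose labels (t : B.-tuple A) : {classic B.-tuple Phi * B.-tuple Phi2} :=
  (map_tuple f t, map_tuple (decomp_info decompose) t).
apply: (reindex_esum _ _
  (fun a : {classic A} =>
     (labels (decompose a).2, (decompose a).2 : B.-tuple {classic A}))).
split.
(* Well-definedness: once [alpha] and [beta] are replaced by the labels of [a], the condition on
   [f'] is (P3) at [a]. *)
- move=> a [/= <- <-]; split; last by rewrite boxE.
  have Fa : signatures f decompose (signature f decompose a) by exists a.
  by exists Fa; rewrite -P3.
(* The image of [a] does not record the first component of [decompose a], but both objects have it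
   equal to [beta]; so the decompositions agree and (P1) applies. *)
- move=> a b; rewrite !inE => -[_ ga] [_ gb] [_ _ ab].
  rewrite -(P1 a) -(P1 b); congr join; apply: injective_projections => //.
  by move: ga gb; rewrite /decomp_info => -> ->.
(* The preimage of [((a1, b1), t)] is [join (beta, t)]: since [t] has labels [a1], the membership
   [Fx] is the premise of (P2). *)
- move=> [[a1 b1] t] [/= [Fx f'x]]; rewrite boxE => -[/= fta gtb].
  have Ft : signatures f decompose (beta, map_tuple f t) by rewrite fta.
  have dec := P2 _ _ Ft.
  exists (join (beta, t)); last by rewrite dec /labels fta gtb.
  split; last by rewrite /decomp_info dec.
  have sE : signature f decompose (join (beta, t)) = (beta, a1).
    by rewrite /signature /decomp_info dec fta.
  have Fj : signatures f decompose (signature f decompose (join (beta, t))).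
    by rewrite sE.
  (* The two arguments of [f'] carry different membership proofs; [eq_exist] reduces their equality
     to [sE]. *)
  rewrite (P3 _ Fj) -f'x; congr f'; exact: eq_exist.
Qed.
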